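(* (Prime Ideal Principle) Let $(L,\vee,\cdot)$ be a multiplicative lattice that satisfies the monotonicity condition and that is $A$-generated for some set $A\subseteq L$. Assume that a subset $F\subseteq L$ satisfies one of the following conditions: (1) $F$ is a left $A$-Oka subset of $L$; (2) $F$ is a right $A$-Oka subset of $L$; (3) $F$ is an $A$-Oka subset of $L$ and the multiplication of $L$ is associative; (4) $F$ is an $A$-Ako subset of $L$. Then every maximal element of $L\setminus F$ is a prime element of $L$.
   Context: A multiplicative lattice $(L,\vee,\cdot)$ is a complete lattice $L$ (least element $0$, largest element $1$) with a binary operation $\cdot\colon L\times L\to L$ such that $xy\leqslant x$ and $xy\leqslant y$ for all $x,y\in L$ (no associativity, commutativity, identity or distributivity is assumed unless stated). An element $p\neq 1$ of $L$ is prime if, for all $x,y\in L$, $xy\leqslant p$ implies $x\leqslant p$ or $y\leqslant p$. The monotonicity condition: $x\leqslant y$ and $x'\leqslant y'$ imply $xx'\leqslant yy'$ for all $x,y,x',y'\in L$. For $A\subseteq L$, $L$ is $A$-generated if every element of $L$ is the supremum of some subset of $A$. For $a,b\in L$ set $(a:_l b):=\bigvee\{x\in L\mid x\cdot b\leqslant a\}$ and $(a:_r b):=\bigvee\{x\in L\mid b\cdot x\leqslant a\}$. Let $A\subseteq L$ and $F\subseteq L$ with $1\in F$. - $F$ is a left $A$-Oka subset if for all $a\in A$, $l\in L$: ($a\vee l\in F$ and $(l:_l a)\in F$) implies $l\in F$. - $F$ is a right $A$-Oka subset if for all $a\in A$, $l\in L$: ($a\vee l\in F$ and $(l:_r a)\in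 F$) implies $l\in F$. - $F$ is an $A$-Oka subset if for all $a\in A$, $l\in L$: ($a\vee l\in F$, $(l:_l a)\in F$ and $(l:_r a)\in F$) implies $l\in F$. - $F$ is an $A$-Ako subset if for all $l\in L$, $a,b\in A$: ($l\vee a\in F$ and $l\vee b\in F$) implies $l\vee (a\cdot b)\in F$. (In all four definitions the condition $1\in F$ is part of the definition.) *)

(* Defs.v *)
From HB Require Import structures.
From mathcomp Require Import all_boot all_order.
From mathcomp Require Import boolp classical_sets.

Set Implicit Arguments.
Unset Strict Implicit.
Unset Printing Implicit Defensive.

Import Order.TTheory.
Local Open Scope classical_set_scope.
Local Open Scope order_scope.

HB.mixin Record hasSup d L of Order.TBLattice d L := {
  lsup : set L -> L;
  lsupP : forall S : set L, isLub S (lsup S)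
}.

#[short(type="completeLatticeType")]
HB.structure Definition CompleteLattice d :=
  { L of Order.TBLattice d L & hasSup d L }.

HB.mixin Record hasLatticeMul d L of Order.TBLattice d L := {
  lmul : L -> L -> L;
  lmul_lel : forall x y : L, (lmul x y <= x)%O;
  lmul_ler : forall x y : L, (lmul x y <= y)%O
}.

#[short(type="multLatticeType")]
HB.structure Definition MultLattice d :=
  { L of CompleteLattice d L & hasLatticeMul d L }.

Declare Scope mult_lattice_scope.
Delimit Scope mult_lattice_scope with ML.
Notation "x * y" := (lmul x y) : mult_lattice_scope.
Local Open Scope mult_lattice_scope.

Definition maximal_in d (L : porderType d) (S : set L) (m : L) : Prop :=
  S m /\ forall x, S x -> m <= x -> x = m.

Section MultLatticeDefs.
Context {d : Order.disp_t} {L : multLatticeType d}.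
Implicit Types (a b l p x y : L) (A F : set L).

Definition prime_element p : Prop :=
  p <> \top /\ forall x y, x * y <= p -> x <= p \/ y <= p.

Definition lmul_monotone : Prop :=
  forall x y x' y' : L, x <= y -> x' <= y' -> x * x' <= y * y'.

Definition generated_by A : Prop :=
  forall x, exists2 S : set L, S `<=` A & x = lsup S.

Definition lresidual a b : L := lsup [set x | x * b <= a].

Definition rresidual a b : L := lsup [set x | b * x <= a].

Definition left_oka A F : Prop :=
  F \top /\
  forall a l, A a -> F (a `|` l) -> F (lresidual l a) -> F l.

Definition right_oka A F : Prop :=
  F \top /\
  forall a l, A a -> F (a `|` l) -> F (rresidual l a) -> F l.

Definition oka A F : Prop :=
  F \top /\
  forall a l, A a -> F (a `|` l) -> F (lresidual l a) ->
    F (rresidual l a) -> F l.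

Definition ako A F : Prop :=
  F \top /\
  forall l a b, A a -> A b -> F (l `|` a) -> F (l `|` b) ->
    F (l `|` (a * b)).

End MultLatticeDefs.

Arguments lmul_monotone {d} L.

(* Main.v *)
(* If x y <= p with x, y not below p, then generation and monotonicity give
   a, b in A, not below p, with a b <= p. Any element above p which is not
   below p lies in F, so F contains p v a, p v b and every residual of p by c
   that dominates some element not below p (residuals of p always dominate p).
   The one-sided Oka conditions put p in F at once, and the Ako condition does
   so through p = p v a b. The two-sided Oka condition needs
   an element of A that annihilates modulo p on both sides: if b a <= p, take
   a itself; otherwise take c in A with c <= b a and c not below p, since
   (b a) b = b (a b) <= p and a (b a) = (a b) a <= p. *)
Require Import Defs.
From mathcomp Require Import all_boot all_order.
From mathcomp Require Import boolp classical_sets.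

Import Order.TTheory.
Local Open Scope classical_set_scope.
Local Open Scope order_scope.
Local Open Scope mult_lattice_scope.

Section PrimeIdealPrinciple.
Context {d : Order.disp_t} {L : multLatticeType d}.
Implicit Types (a b c p x y : L) (A F : set L).

Lemma le_lsup (S : set L) x : S x -> x <= lsup S.
Proof. by have [ub _] := lsupP S; exact: ub. Qed.

(** Otherwise [p] bounds every member of a subset of [A] with supremum [x], forcing [x <= p]. *)
Lemma generated_nle A x p : generated_by A -> ~ x <= p ->
  exists a, [/\ A a, a <= x & ~ a <= p].
Proof.
move=> genA xp; have [S SA xE] := genA x.
apply: contrapT => noa; apply: xp; rewrite xE.
have [_] := lsupP S; apply=> s Ss; apply: contrapT => sp; apply: noa.
by exists s; split=> //; [exact: SA | rewrite xE; exact: le_lsup].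
Qed.

Lemma maximal_in_setC_above F p x :
  maximal_in (~` F) p -> p <= x -> ~ x <= p -> F x.
Proof.
move=> [_ maxp] px xp; apply: contrapT => nFx; apply: xp.
by rewrite (maxp x nFx px).
Qed.

Lemma maximal_in_setC_join F p x :
  maximal_in (~` F) p -> ~ x <= p -> F (p `|` x)%O.
Proof.
move=> maxp xp; apply: maximal_in_setC_above maxp _ _; first exact: leUl.
by rewrite leUx => /andP[].
Qed.

Lemma maximal_in_setC_lresidual F p a x :
  maximal_in (~` F) p -> ~ x <= p -> x * a <= p -> F (lresidual p a).
Proof.
move=> maxp xp xap; apply: maximal_in_setC_above maxp _ _.
  by apply: le_lsup; exact: lmul_lel.
by move=> rp; apply: xp; apply: le_trans rp; exact: le_lsup.
Qed.

Lemma maximal_in_setC_rresidual F p a x :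
  maximal_in (~` F) p -> ~ x <= p -> a * x <= p -> F (rresidual p a).
Proof.
move=> maxp xp axp; apply: maximal_in_setC_above maxp _ _.
  by apply: le_lsup; exact: lmul_ler.
by move=> rp; apply: xp; apply: le_trans rp; exact: le_lsup.
Qed.

(** The witnesses [x] and [y] serve to put the left and right residuals of a maximal [p] by the
    single generator [c] into [F]. *)
Lemma two_sided_annihilator A a b p :
  lmul_monotone L -> generated_by A -> associative (@lmul d L) ->
  A a -> ~ a <= p -> ~ b <= p -> a * b <= p ->
  exists c x y, [/\ A c, ~ c <= p, ~ x <= p /\ x * c <= p
                  & ~ y <= p /\ c * y <= p].
Proof.
move=> mono genA assoc Aa ap bp abp.
have [bap|/(generated_nle _ _ _ genA)] := pselect (b * a <= p).
  by exists a, b, b.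
move=> [c [Ac cba cp]]; exists c, a, b; split=> //; split=> //.
  apply: le_trans (mono _ _ _ _ (lexx a) cba) _.
  by rewrite assoc; exact: le_trans (lmul_lel _ _) abp.
apply: le_trans (mono _ _ _ _ cba (lexx b)) _.
by rewrite -assoc; exact: le_trans (lmul_ler _ _) abp.
Qed.

End PrimeIdealPrinciple.

Theorem proposition4p4 (d : Order.disp_t) (L : multLatticeType d)
    (A F : set L)
    (L_monotone : lmul_monotone L)
    (L_generated : generated_by A)
    (F_cond : [\/ left_oka A F,
                  right_oka A F,
                  oka A F /\ associative (@lmul d L)
                | ako A F]) :
  forall p : L, maximal_in (~` F)%classic p -> prime_element p.
Proof.
move=> p maxp; have [nFp _] := maxp; split.
  (* Each of the four conditions includes [F \top], while [p] lies outside [F]. *)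
  by move=> pT; apply: nFp; rewrite pT; case: F_cond => [[]|[]|[[]]|[]].
move=> x y xyp; apply: contrapT => /not_orP[xp yp].
have [a [Aa ax ap]] := generated_nle _ _ _ L_generated xp.
have [b [Ab byy bp]] := generated_nle _ _ _ L_generated yp.
have abp : a * b <= p by apply: le_trans xyp; exact: L_monotone.
apply: nFp; case: F_cond => [[_ H]|[_ H]|[[_ H] assoc]|[_ H]].
(* From [a * b <= p], the left residual by [b] dominates [a]; in the right case, the residual by [a]
   dominates [b]. *)
- apply: (H b) => //; first by rewrite joinC; exact: maximal_in_setC_join.
  exact: maximal_in_setC_lresidual maxp ap abp.
- apply: (H a) => //; first by rewrite joinC; exact: maximal_in_setC_join.
  exact: maximal_in_setC_rresidual maxp bp abp.
- have [c [u [v [Ac cp [up ucp] [vp cvp]]]]] :=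
    two_sided_annihilator _ _ _ _ L_monotone L_generated assoc Aa ap bp abp.
  apply: (H c) => //; first by rewrite joinC; exact: maximal_in_setC_join.
    exact: maximal_in_setC_lresidual maxp up ucp.
  exact: maximal_in_setC_rresidual maxp vp cvp.
- rewrite -(join_l abp).
  by apply: H => //; exact: maximal_in_setC_join.
Qed.
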